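(* If $\Gamma$ is a locally finitely determined group of local similarities on a compact ultrametric space $X$, then $\Gamma$ has a zipper action.
   Context: An ultrametric space is a metric space $(X,d)$ with $d(x,y)\le\max\{d(x,z),d(z,y)\}$ for all $x,y,z\in X$. Write $B(x,\epsilon)=\{y : d(x,y)<\epsilon\}$ and $\bar B(x,\epsilon)=\{y : d(x,y)\le\epsilon\}$ for open and closed balls ($\epsilon>0$). For $\lambda>0$, a map $g\colon X\to Y$ of metric spaces is a $\lambda$-similarity if $d_Y(gx,gy)=\lambda d_X(x,y)$ for all $x,y\in X$; a similarity is a $\lambda$-similarity for some $\lambda>0$. A homeomorphism $g\colon X\to X$ is a local similarity if for every $x\in X$ there exist $r,\lambda>0$ such that $g$ restricts to a surjective $\lambda$-similarity $B(x,r)\to B(gx,\lambda r)$. $LS(X)$ is the group of all local similarities from $X$ onto $X$; its subgroups are given the discrete topology. Let $X$ be a compact ultrametric space. A finite similarity structure for $X$ is a function $\mathrm{Sim}$ assigning to each ordered pair $B_1,B_2$ of closed balls in $X$ a (possibly empty) finite set $\mathrm{Sim}(B_1,B_2)$ of surjective similarities $B_1\to B_2$ such that for all closed balls $B_1,B_2,B_3$ in $X$: (1) $\mathrm{id}_{B_1}\in\mathrm{Sim}(B_1,B_1)$; (2) if $h\in\mathrm{Sim}(B_1,B_2)$ then $h^{-1}\in\mathrm{Sim}(B_2,B_1)$; (3) if $h_1\in\mathrm{Sim}(B_1,B_2)$ and $h_2\in\mathrm{Sim}(B_2,B_3)$ then $h_2h_1\in\mathrm{Sim}(B_1,B_3)$;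 (4) if $h\in\mathrm{Sim}(B_1,B_2)$ and $B_3\subseteq B_1$ then $h|B_3\in\mathrm{Sim}(B_3,h(B_3))$. A subgroup $\Gamma\le LS(X)$ is locally determined by $\mathrm{Sim}$ if for every $g\in\Gamma$ and every $x\in X$ there exist $r,\lambda>0$ such that $g|\colon\bar B(x,r)\to\bar B(gx,\lambda r)$ is a surjective $\lambda$-similarity belonging to $\mathrm{Sim}(\bar B(x,r),\bar B(gx,\lambda r))$. $\Gamma$ is a locally finitely determined group of local similarities on $X$ if it is locally determined by some finite similarity structure for $X$. A discrete group $\Gamma$ has a zipper action if there is a left action of $\Gamma$ on a set $\mathcal E$ and a subset $Z\subseteq\mathcal E$ such that (1) for every $g\in\Gamma$, the symmetric difference $gZ\,\triangle\,Z$ is finite, and (2) for every $r>0$, the set $\{g\in\Gamma : |gZ\,\triangle\,Z|\le r\}$ is finite. *)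

(* Defs.v *)
From HB Require Import structures.
From mathcomp Require Import all_boot all_order all_algebra.
From mathcomp Require Import all_classical all_reals topology.

Set Implicit Arguments.
Unset Strict Implicit.
Unset Printing Implicit Defensive.

Import Order.TTheory GRing.Theory Num.Theory.

Local Open Scope classical_set_scope.
Local Open Scope ring_scope.

Section Metric.
Context {R : realType}.

Definition ultrametric (X : metricType R) : Prop :=
  forall x y z : X, mdist x y <= Num.max (mdist x z) (mdist z y).

(* The library's [closed_ball] is the topological closure of the open ball;
   in an ultrametric space that is the open ball itself. *)
Definition cball (X : metricType R) (x : X) (e : R) : set X :=
  [set y | mdist x y <= e].

Definition is_cball (X : metricType R) (B : set X) : Prop :=
  exists (x : X) (e : R), 0 < e /\ B = cball x e.

(* Maps between subsets [A] and [B] are functions between the subtypes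
   [A] and [B], so that equality of such maps is equality of functions on [A]. *)
Definition similarity_with (X Y : metricType R) (l : R)
    (A : set X) (B : set Y) (h : A -> B) : Prop :=
  forall x y : A,
    mdist (val (h x)) (val (h y)) = l * mdist (val x) (val y).

Definition similarity (X Y : metricType R)
    (A : set X) (B : set Y) (h : A -> B) : Prop :=
  exists l : R, 0 < l /\ similarity_with l h.

Definition surjective (T U : Type) (h : T -> U) : Prop :=
  forall y : U, exists x : T, h x = y.

Definition restricts_to (X Y : Type) (g : X -> Y)
    (A : set X) (B : set Y) (h : A -> B) : Prop :=
  forall x : A, val (h x) = g (val x).

Definition homeomorphism (X Y : topologicalType) (g : X -> Y) : Prop :=
  continuous g /\
  exists f : Y -> X, [/\ cancel g f, cancel f g & continuous f].

Definition local_similarity (X : metricType R) (g : X -> X) : Prop :=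
  homeomorphism g /\
  forall x : X, exists r l : R, [/\ 0 < r, 0 < l &
    exists h : set_type (ball x r) -> set_type (ball (g x) (l * r)),
      [/\ restricts_to g h, similarity_with l h & surjective h]].

End Metric.

Section LocalSimilarityGroup.
Context {R : realType} (X : metricType R).

Record LS := MkLS {
  LS_fun :> X -> X;
  LS_prop : local_similarity LS_fun
}.

HB.instance Definition _ := gen_eqMixin LS.
HB.instance Definition _ := gen_choiceMixin LS.

Lemma LS_ext (g h : LS) : LS_fun g =1 LS_fun h -> g = h.
Proof.
case: g h => [g pg] [h ph] /= /funext gh; subst h.
by congr MkLS; exact: Prop_irrelevance.
Qed.

Lemma mem_ballE (x y : X) (r : R) :
  (y \in (ball x r : set X)) = (mdist x y < r).
Proof.
by apply/idP/idP => [/set_mem|xy]; [|apply/mem_set]; rewrite ballEmdist.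
Qed.

Lemma ball_val (x : X) (r : R) (y : set_type (ball x r)) :
  mdist x (val y) < r.
Proof. by rewrite -mem_ballE; exact: valP. Qed.

Lemma ball_similarityP (g : X -> X) (x : X) (r l : R) : 0 < l ->
  (exists h : set_type (ball x r) -> set_type (ball (g x) (l * r)),
      [/\ restricts_to g h, similarity_with l h & surjective h]) <->
  ((forall y z, mdist x y < r -> mdist x z < r ->
      mdist (g y) (g z) = l * mdist y z) /\
   (forall y, mdist (g x) y < l * r -> exists2 z, mdist x z < r & g z = y)).
Proof.
move=> l0; split.
- case=> h [hg hs hsurj]; split.
    move=> y z; rewrite -!mem_ballE => yb zb.
    by have := hs (SigSub yb) (SigSub zb); rewrite !hg.
  move=> y; rewrite -mem_ballE => yb.
  have [z hz] := hsurj (SigSub yb).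
  by exists (val z); [exact: ball_val|rewrite -hg hz].
- case=> gs gsurj.
  have gb (y : set_type (ball x r)) :
      g (val y) \in (ball (g x) (l * r) : set X).
    have xy := ball_val y.
    rewrite mem_ballE gs ?ltr_pM2l// mdistxx.
    exact: le_lt_trans (mdist_ge0 _ _) xy.
  exists (fun y => SigSub (gb y)); split => //.
    by move=> y z /=; apply: gs; exact: ball_val.
  move=> y; have [z xz gz] := gsurj _ (ball_val y).
  move: xz; rewrite -mem_ballE => zb.
  by exists (SigSub zb); apply: val_inj.
Qed.

Lemma local_similarity_id : local_similarity (@id X).
Proof.
split; first by split; [move=> x; exact: cvg_id|exists id; split => // x; exact: cvg_id].
move=> x; exists 1, 1; split => //; apply/ball_similarityP => //.
by rewrite mulr1; split=> [y z _ _|y xy]; [rewrite mul1r|exists y].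
Qed.

Lemma local_similarity_comp (f g : X -> X) :
  local_similarity f -> local_similarity g -> local_similarity (f \o g).
Proof.
move=> [[cf [f' [fK f'K cf']]] lf] [[cg [g' [gK g'K cg']]] lg]; split.
  split; first by move=> x; apply: continuous_comp; [exact: cg|exact: cf].
  exists (g' \o f'); split; [exact: can_comp|exact: can_comp|].
  by move=> x; apply: continuous_comp; [exact: cf'|exact: cg'].
move=> x; have [r [l [r0 l0 /(ball_similarityP _ _ _ l0)[gs gsurj]]]] := lg x.
have [s [m [s0 m0 /(ball_similarityP _ _ _ m0)[fs fsurj]]]] := lf (g x).
have ml0 : 0 < m * l by rewrite mulr_gt0.
pose t := Num.min r (s / l).
have t0 : 0 < t by rewrite lt_min r0 divr_gt0.
have tr y : mdist x y < t -> mdist x y < r by rewrite lt_min => /andP[].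
have lts : l * t <= s by rewrite mulrC -ler_pdivlMr// ge_min lexx orbT.
have gsx y : mdist x y < r -> mdist (g x) (g y) = l * mdist x y.
  move=> xy; apply: gs => //; rewrite mdistxx; exact: le_lt_trans (mdist_ge0 _ _) xy.
have tl y : mdist x y < t -> mdist (g x) (g y) < s.
  move=> xy; rewrite gsx; last exact: tr.
  by apply: lt_le_trans lts; rewrite ltr_pM2l.
exists t, (m * l); split => //; apply/ball_similarityP => //=; split.
  move=> y z xy xz; rewrite fs; [|exact: tl..].
  by rewrite gs ?mulrA//; exact: tr.
move=> y fy; have [|z gxz fz] := fsurj y.
  by apply: lt_le_trans fy _; rewrite -mulrA ler_pM2l.
have fsx : mdist (f (g x)) (f z) = m * mdist (g x) z.
  by apply: fs => //; rewrite mdistxx.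
have gxzt : mdist (g x) z < l * t.
  by move: fy; rewrite -fz fsx -mulrA ltr_pM2l.
have [|w xw gw] := gsurj z.
  by apply: lt_le_trans gxzt _; rewrite ler_pM2l// ge_min lexx.
exists w; last by rewrite gw.
by move: gxzt; rewrite -gw gsx// ltr_pM2l.
Qed.

Lemma LS_inverse (g : LS) :
  exists f : X -> X, [/\ cancel g f, cancel f g & local_similarity f].
Proof.
case: g => g /= [[cg [f [gK fK cf]]] lg]; exists f; split => //.
split; first by split => //; exists g.
move=> y; have [r [l [r0 l0 /(ball_similarityP _ _ _ l0)]]] := lg (f y).
rewrite fK => -[gs gsurj].
have l'0 : 0 < l^-1 by rewrite invr_gt0.
exists (l * r), l^-1; split; [exact: mulr_gt0|by []|].
apply/ball_similarityP => //; rewrite mulrA mulVf ?gt_eqF// mul1r; split.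
  move=> _ _ /gsurj[z yz <-] /gsurj[w yw <-].
  by rewrite !gK gs// mulrA mulVf ?gt_eqF// mul1r.
move=> z fyz; exists (g z); last exact: gK.
rewrite -[in X in mdist X _](fK y) gs ?ltr_pM2l// mdistxx//.
Qed.

Definition LS_one : LS := MkLS local_similarity_id.
Definition LS_mul (g h : LS) : LS :=
  MkLS (local_similarity_comp (LS_prop g) (LS_prop h)).
Definition LS_inv (g : LS) : LS :=
  let: exist _ p := cid (LS_inverse g) in let: And3 _ _ pf := p in MkLS pf.

Lemma LS_invP (g : LS) : cancel g (LS_inv g) /\ cancel (LS_inv g) g.
Proof. by rewrite /LS_inv; case: cid => f [/= ? ? ?]. Qed.

Lemma LS_mulA : associative LS_mul.
Proof. by move=> f g h; apply: LS_ext. Qed.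
Lemma LS_mul1g : left_id LS_one LS_mul.
Proof. by move=> f; apply: LS_ext. Qed.
Lemma LS_mulg1 : right_id LS_one LS_mul.
Proof. by move=> f; apply: LS_ext. Qed.
Lemma LS_mulVg : left_inverse LS_one LS_inv LS_mul.
Proof. by move=> f; apply: LS_ext => x /=; rewrite (LS_invP f).1. Qed.
Lemma LS_mulgV : right_inverse LS_one LS_inv LS_mul.
Proof. by move=> f; apply: LS_ext => x /=; rewrite (LS_invP f).2. Qed.

HB.instance Definition _ :=
  isGroup.Build LS LS_mulA LS_mul1g LS_mulg1 LS_mulVg LS_mulgV.

End LocalSimilarityGroup.

Section SubsetMaps.
Context {X : Type} (B1 B2 B3 : set X) (h : B1 -> B2).

Definition sub_image : set X :=
  [set y | exists x : B1, B3 (val x) /\ val (h x) = y].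

Hypothesis s : B3 `<=` B1.

Definition sub_incl (x : B3) : B1 := SigSub (mem_set (s (set_mem (valP x)))).

Lemma sub_restr_subproof (x : B3) : val (h (sub_incl x)) \in sub_image.
Proof.
by apply/mem_set; exists (sub_incl x); split => //; exact: set_mem (valP x).
Qed.

(* the restriction [h|B3 : B3 -> h(B3)] *)
Definition sub_restr (x : B3) : sub_image := SigSub (sub_restr_subproof x).

End SubsetMaps.

(* [Sim] is defined on all pairs of subsets, but only its values on closed balls
   are constrained or used.  In [Sim_restr], [h(B3)] is itself a closed ball,
   because [h] is a surjective similarity between closed balls. *)
Record finite_similarity_structure (R : realType) (X : metricType R)
    (Sim : forall B1 B2 : set X, set (B1 -> B2)) : Prop := {
  Sim_finite : forall B1 B2 : set X, is_cball B1 -> is_cball B2 ->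
    finite_set (Sim B1 B2);
  Sim_similarity : forall B1 B2 : set X, is_cball B1 -> is_cball B2 ->
    forall h : B1 -> B2, Sim B1 B2 h -> similarity h /\ surjective h;
  Sim_id : forall B1 : set X, is_cball B1 -> Sim B1 B1 id;
  Sim_inv : forall B1 B2 : set X, is_cball B1 -> is_cball B2 ->
    forall (h : B1 -> B2) (h' : B2 -> B1), cancel h h' -> cancel h' h ->
    Sim B1 B2 h -> Sim B2 B1 h';
  Sim_comp : forall B1 B2 B3 : set X,
    is_cball B1 -> is_cball B2 -> is_cball B3 ->
    forall (h1 : B1 -> B2) (h2 : B2 -> B3),
    Sim B1 B2 h1 -> Sim B2 B3 h2 -> Sim B1 B3 (h2 \o h1);
  Sim_restr : forall B1 B2 B3 : set X,
    is_cball B1 -> is_cball B2 -> is_cball B3 ->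
    forall (h : B1 -> B2) (s : B3 `<=` B1),
    Sim B1 B2 h -> Sim B3 (sub_image B3 h) (sub_restr h s)
}.

Definition locally_determined (R : realType) (X : metricType R)
    (G : set (LS X)) (Sim : forall B1 B2 : set X, set (B1 -> B2)) : Prop :=
  forall g : LS X, G g -> forall x : X, exists r l : R, [/\ 0 < r, 0 < l &
    exists h : cball x r -> cball (g x) (l * r),
      [/\ restricts_to g h, similarity_with l h, surjective h &
          Sim (cball x r) (cball (g x) (l * r)) h]].

Definition locally_finitely_determined (R : realType) (X : metricType R)
    (G : set (LS X)) : Prop :=
  exists Sim : forall B1 B2 : set X, set (B1 -> B2),
    finite_similarity_structure Sim /\ locally_determined G Sim.

Definition left_action (G : groupType) (E : Type) (act : G -> E -> E) : Prop :=
  (forall x, act 1%g x = x) /\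
  (forall g h x, act (g * h)%g x = act g (act h x)).

Definition card_at_most (R : realType) (T : Type) (A : set T) (r : R) : Prop :=
  exists2 n : nat, (A #= `I_n)%card & n%:R <= r.

Definition has_zipper_action (R : realType) (G : groupType) : Prop :=
  exists (E : Type) (act : G -> E -> E) (Z : set E),
    [/\ left_action act,
        forall g : G, finite_set ((act g @` Z) `+` Z) &
        forall r : R, 0 < r ->
          finite_set [set g : G | card_at_most ((act g @` Z) `+` Z) r]].

(* Main.v *)
From HB Require Import structures.
Require Import Defs.
From mathcomp Require Import all_boot all_order all_algebra.
From mathcomp Require Import finmap all_classical all_reals topology.

Set Implicit Arguments.
Unset Strict Implicit.
Unset Printing Implicit Defensive.

Import Order.TTheory GRing.Theory Num.Theory.

Local Open Scope classical_set_scope.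
Local Open Scope ring_scope.

(** Let [Sim] be a finite similarity structure that locally determines [Gamma].
The action is on sets of pairs (f, A), with f a local similarity and A a closed
ball, by left translation of the first component.  The zipper consists of one
such set for each closed ball B, the class [zclass B] of the inclusion of B:
all (f, A) whose restriction f : A -> B belongs to [Sim].  Composition and
inversion in [Sim] give [translate_zclass]: g carries the class of B to that
of C exactly when g restricts to an element of [Sim] from B to C.

Call a ball B bad for g when g restricted to B is in no [Sim B C].  Distinct
balls have distinct classes, so [zipper_moved] and [zipper_missed] make
gZ \ Z a copy of the set of balls that are bad for g, and Z \ gZ a copy of the
set of balls that are bad for g^-1.  Both zipper axioms thus concern bad balls.

- Every point has a neighbourhood ball on which g belongs to [Sim], and then a
  bad ball cannot be contained in it.  By compactness finitely many of these
  balls cover X, and since balls are nested or disjoint, each bad ball is a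
  union of members of the cover; so there are finitely many ([finite_cballs],
  [finite_bad]).

- Suppose that g and g^-1 have at most n bad balls each.  Let B be maximal among
  the balls around x that are not bad.  All balls strictly larger than B are bad
  for g, so there are at most n of them: B has depth at most n.  The image g(B)
  is maximal for g^-1 ([max_good_image]) and hence has depth at most n too.
  Only finitely many balls have depth at most n ([finite_shallow]), and
  between two given balls [Sim] has finitely many maps; therefore the graph of
  g is a union of members of a finite family that depends on n only, which
  leaves finitely many g ([finite_tame]). *)

(** * Finiteness and compactness *)

(** The hypothesis says that each member of [P] is a union of members of [V],
so that it is determined by a subset of [V]. *)
Lemma finite_unions (T : Type) (V P : set (set T)) :
  finite_set V ->
  (forall B, P B -> forall y, B y -> exists2 W, V W & W y /\ W `<=` B) ->
  finite_set P.
Proof.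
move=> Vfin PV.
pose U (F : {fset set T}) := \bigcup_(W in [set` F]) W.
apply: (@sub_finite_set _ _ (U @` [set` fpowerset (fset_set V)])); last first.
  exact/finite_image/finite_fset.
move=> B PB; have subfin : finite_set [set W | V W /\ W `<=` B].
  by apply: sub_finite_set Vfin => W [].
exists (fset_set [set W | V W /\ W `<=` B]).
  by rewrite /= fpowersetE -fset_set_sub// => W [].
rewrite /U fset_setK//; apply/seteqP; split=> [y [W [_ WB] Wy]|y By].
  exact: WB.
by have [W VW [Wy WB]] := PV _ PB _ By; exists W.
Qed.

Lemma compact_finite_subcover (T : topologicalType) (U : T -> set T) :
  compact [set: T] -> (forall x, open (U x)) -> (forall x, U x x) ->
  exists2 D : set T, finite_set D & forall y, exists2 x, D x & U x y.
Proof.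
move=> Tc Uo Ux; have [[x0 _]|T0] := pselect (exists x : T, True); last first.
  by exists set0 => // y; case: T0; exists y.
(* A base point is needed to speak of covers through [compact_cover]. *)
pose pT : ptopologicalType := HB.pack T (isPointed.Build T x0).
have : cover_compact [set: pT] by rewrite -compact_cover; exact: Tc.
case/(_ T setT U (fun x _ => Uo x)); first by move=> x _; exists x.
move=> D _ DU; exists [set` D]; first exact: finite_fset.
by move=> y; have [x Dx Uxy] := DU y I; exists x.
Qed.

(** * Balls in an ultrametric space *)

Section Balls.
Context {R : realType} {X : metricType R}.
Hypothesis um : ultrametric X.
Implicit Types (x y z : X) (A B C : set X).

Lemma cball_center x (e : R) : 0 < e -> cball x e x.
Proof. by move=> e0; rewrite /cball /= mdistxx ltW. Qed.

Lemma is_cball_nonempty B : is_cball B -> exists x, B x.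
Proof. by case=> x [e [e0 ->]]; exists x; exact: cball_center. Qed.

Lemma is_cball_cball x (e : R) : 0 < e -> is_cball (cball x e).
Proof. by exists x, e. Qed.

(** Every point of an ultrametric ball is a centre of it. *)
Lemma cball_recenter x y (e : R) : cball x e y -> cball x e = cball y e.
Proof.
rewrite /cball /= => xy; apply/seteqP; split => z /= h.
  by apply: le_trans (um _ _ x) _; rewrite ge_max (metric_sym y) xy.
by apply: le_trans (um _ _ y) _; rewrite ge_max xy.
Qed.

Lemma cball_nested A B z : is_cball A -> is_cball B -> A z -> B z ->
  A `<=` B \/ B `<=` A.
Proof.
move=> [x [e [_ ->]]] [y [d [_ ->]]] /cball_recenter-> /cball_recenter->.
by case: (leP e d) => [ed|/ltW de]; [left|right] => w /le_trans; apply.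
Qed.

Lemma open_cball B : is_cball B -> open B.
Proof.
move=> [x [e [e0 ->]]]; rewrite openE => y /cball_recenter ->.
apply/nbhs_ballP; exists e => //= z; rewrite ballEmdist; exact: ltW.
Qed.

Hypothesis Xc : compact [set: X].

(** Finitely many of the balls [U] cover [X].  A member of [P] that meets one
of them contains it, because the two are nested, so it is the union of those
that it contains. *)
Lemma finite_cballs (P : set (set X)) :
  P `<=` @is_cball R X ->
  (forall x, exists U, [/\ is_cball U, U x & forall B, P B -> ~ B `<` U]) ->
  finite_set P.
Proof.
move=> Pball /choice[U HU].
have Ub x : is_cball (U x) by case: (HU x).
have Ux x : U x x by case: (HU x).
have UP x B : P B -> ~ B `<` U x by case: (HU x) => _ _; apply.
have [D Dfin DU] := compact_finite_subcover Xc (fun x => open_cball (Ub x)) Ux.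
apply: (@finite_unions _ (U @` D)); first exact: finite_image.
move=> B PB y By; have [x Dx Uxy] := DU y.
exists (U x) => //; split => //.
have [//|BU] := cball_nested (Ub x) (Pball _ PB) Uxy By.
by apply: contrapT => UB; exact: (UP x B).
Qed.

Definition superballs B := [set C | is_cball C /\ B `<` C].

(** Around any [y], the ball of the same radius as [B] is either disjoint from
[B] or equal to it, so no superball of [B] is strictly inside it. *)
Lemma finite_superballs B : is_cball B -> finite_set (superballs B).
Proof.
move=> [x [e [e0 ->]]]; apply: finite_cballs => [C []//|y].
exists (cball y e); split; [exact: is_cball_cball|exact: cball_center|].
move=> C [_ [BC nCB]] [Cy _].
by apply: nCB; rewrite -(cball_recenter (Cy _ (BC _ (cball_center x e0)))).
Qed.

Definition depth B : nat := #|` fset_set (superballs B)|.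

Lemma depth_lt B C : is_cball B -> is_cball C -> B `<` C ->
  (depth C < depth B)%N.
Proof.
move=> Bb Cb [BC nCB]; apply: fproper_ltn_card; rewrite fproperE.
have finB := finite_superballs Bb; have finC := finite_superballs Cb.
apply/andP; split.
  rewrite -fset_set_sub// => D [Db [CD nDC]]; split => //; split.
    exact: subset_trans CD.
  by move=> DB; apply: nDC; exact: subset_trans DB _.
apply/negP; rewrite -fset_set_sub// => /(_ C)[] => // _ [_]; exact.
Qed.

(** Descending to half the distance to another point adds at least one
superball; the descent can only stop at an isolated point. *)
Lemma deep_cball n x :
  exists2 U, is_cball U /\ U x & U = [set x] \/ (n <= depth U)%N.
Proof.
elim: n => [|n [U [Ub Ux] HU]].
  exists (cball x 1); last by right.
  by split; [exact: is_cball_cball|exact: cball_center].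
have [U1|nU1] := pselect (U = [set x]); first by exists U => //; left.
have nU : (n <= depth U)%N by case: HU.
have [y Uy yx] : exists2 y, U y & y <> x.
  apply: contrapT => nex; apply: nU1; apply/seteqP; split=> [y Uy|_ ->//].
  by apply: contrapT => yx; apply: nex; exists y.
have xy0 : 0 < mdist x y by rewrite mdist_gt0 eq_sym; exact/eqP.
have e0 : 0 < mdist x y / 2 by rewrite divr_gt0.
have Vb : is_cball (cball x (mdist x y / 2)) by exact: is_cball_cball.
have nUV : ~ U `<=` cball x (mdist x y / 2).
  move=> /(_ _ Uy); rewrite /cball /= ler_pdivlMr// ger_pMr// leNgt.
  by rewrite ltr1n.
exists (cball x (mdist x y / 2)); first by split => //; exact: cball_center.
right; apply: leq_ltn_trans nU (depth_lt Vb Ub _); split => //.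
by have [//|] := cball_nested Vb Ub (cball_center x e0) Ux.
Qed.

(** By [depth_lt] a ball of depth at most [n] is never strictly inside the
neighbourhoods of [deep_cball], so [finite_cballs] applies. *)
Lemma finite_shallow n : finite_set [set B | is_cball B /\ (depth B <= n)%N].
Proof.
apply: finite_cballs => [B []//|x].
have [U [Ub Ux] HU] := deep_cball n x; exists U; split => // B [Bb Bn] BU.
case: HU => [U1|nU].
  have [y By] := is_cball_nonempty Bb.
  case: BU; rewrite U1 => B1 nB1; apply: nB1 => _ ->.
  by rewrite -(B1 _ By).
by have := depth_lt Bb Ub BU; rewrite ltnNge (leq_trans Bn nU).
Qed.

End Balls.

(** * Maps that agree with the similarity structure on a ball *)

Definition sim_on {X : Type} (Sim : forall A B : set X, set (A -> B))
    (g : X -> X) (A B : set X) : Prop :=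
  exists2 h : A -> B, Sim A B h & restricts_to g h.

Definition graph {X : Type} (g : X -> X) (A : set X) : set (X * X) :=
  (fun x => (x, g x)) @` A.

Section SimOn.
Context {R : realType} {X : metricType R}.
Hypothesis um : ultrametric X.
Variable Sim : forall A B : set X, set (A -> B).
Hypothesis fss : finite_similarity_structure Sim.
Implicit Types (A B C : set X) (f g : X -> X).

Lemma sim_on_id A : is_cball A -> sim_on Sim id A A.
Proof. by move=> Ab; exists id => //; exact: Sim_id fss _ Ab. Qed.

Lemma sim_on_image g A B : is_cball A -> is_cball B -> sim_on Sim g A B ->
  g @` A = B.
Proof.
move=> Ab Bb [h Sh hg]; have [_ hsurj] := Sim_similarity fss Ab Bb Sh.
apply/seteqP; split=> [_ [x /mem_set xA <-]|y /mem_set yB].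
  by rewrite -(hg (SigSub xA)); exact: set_mem (valP _).
have [x hx] := hsurj (SigSub yB).
by exists (val x); [exact: set_mem (valP x)|rewrite -hg hx].
Qed.

Lemma sim_on_comp f g A B C : is_cball A -> is_cball B -> is_cball C ->
  sim_on Sim f A B -> sim_on Sim g B C -> sim_on Sim (g \o f) A C.
Proof.
move=> Ab Bb Cb [h Sh hf] [k Sk kg]; exists (k \o h).
  exact: (Sim_comp fss Ab Bb Cb).
by move=> x /=; rewrite kg hf.
Qed.

Lemma sim_on_inv f g A B : is_cball A -> is_cball B ->
  cancel g f -> cancel f g -> sim_on Sim g A B -> sim_on Sim f B A.
Proof.
move=> Ab Bb gK fK gAB; have gA := sim_on_image Ab Bb gAB.
have [h Sh hg] := gAB.
have fB (y : B) : f (val y) \in A.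
  apply/mem_set; have := set_mem (valP y); rewrite -{1}gA => -[x Ax <-].
  by rewrite gK.
exists (fun y => SigSub (fB y)) => //.
apply: (Sim_inv fss Ab Bb _ _ Sh) => x; apply: val_inj => /=.
  by rewrite hg gK.
by rewrite hg /= fK.
Qed.

(** The image of [C] has to be exhibited as a closed ball, for [Sim] is only
constrained on those. *)
Lemma sim_on_restr g A B C : is_cball A -> is_cball B -> is_cball C ->
  C `<=` A -> sim_on Sim g A B ->
  exists2 D, is_cball D & sim_on Sim g C D.
Proof.
move=> Ab Bb Cb CA [h Sh hg]; exists (sub_image C h); last first.
  exists (sub_restr h CA); first exact: (Sim_restr fss Ab Bb Cb).
  by move=> x; rewrite /= hg.
have [[l [l0 hl]] hsurj] := Sim_similarity fss Ab Bb Sh.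
have [y [s [s0 Cys]]] := Cb; have [b [t [t0 Bbt]]] := Bb.
have Cy : C y by rewrite Cys; exact: cball_center.
pose yA : A := SigSub (mem_set (CA _ Cy)).
have Bt (z : B) : B = cball (val z) t.
  rewrite [LHS]Bbt; apply: cball_recenter => //; rewrite -Bbt.
  exact: set_mem (valP z).
(* The radius l * s alone could be too large: C may be a ball of radius s only
   because A has no further points, while B has points around it. *)
exists (val (h yA)), (Num.min (l * s) t); split.
  by rewrite lt_min t0 mulr_gt0.
apply/seteqP; split=> [_ [x [Cx <-]]|z] /=.
  rewrite /cball /= le_min; apply/andP; split.
    by rewrite hl ler_pM2l//; move: Cx; rewrite Cys.
  by have := set_mem (valP (h x)); rewrite {1}(Bt (h yA)).
rewrite /cball /= le_min => /andP[zls zt].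
have zB : z \in B by apply/mem_set; rewrite (Bt (h yA)).
have [x hx] := hsurj (SigSub zB); exists x; rewrite hx; split => //.
by rewrite Cys /cball /= -(ler_pM2l l0) -(hl yA) hx.
Qed.

Lemma finite_graphs A B : is_cball A -> is_cball B ->
  finite_set [set graph g A | g in [set g | sim_on Sim g A B]].
Proof.
move=> Ab Bb.
apply: (@sub_finite_set _ _
  ((fun h : A -> B => range (fun x : A => (val x, val (h x)))) @` @Sim A B)).
  move=> _ [g [h Sh hg] <-]; exists h => //; apply/seteqP; split => -[x y].
    by case=> u _ [<- <-]; exists (val u); [exact: set_mem (valP u)|rewrite hg].
  case=> u /mem_set uA [<- <-]; exists (SigSub uA) => //.
  by rewrite hg.
exact/finite_image/(Sim_finite fss).
Qed.

End SimOn.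

(** * Balls on which a map leaves the similarity structure *)

Section Bad.
Context {R : realType} {X : metricType R}.
Hypothesis um : ultrametric X.
Hypothesis Xc : compact [set: X].
Variable Sim : forall A B : set X, set (A -> B).
Hypothesis fss : finite_similarity_structure Sim.
Implicit Types (A B C : set X) (g : LS X).

Definition bad g : set (set X) :=
  [set B | is_cball B /\ ~ exists2 C, is_cball C & sim_on Sim g B C].

Lemma not_bad g B : is_cball B -> ~ bad g B ->
  exists2 C, is_cball C & sim_on Sim g B C.
Proof. by move=> Bb nbad; apply: contrapT => nex; exact: nbad. Qed.

Lemma sim_on_LSinv g A B : is_cball A -> is_cball B ->
  sim_on Sim g A B <-> sim_on Sim (g^-1)%g B A.
Proof.
move=> Ab Bb; have [gK fK] := LS_invP g.
by split; apply: (sim_on_inv fss).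
Qed.

(** What local determination gives for each element of the group; by
[sim_on_restr] the radius of [U] may be shrunk at will. *)
Definition tame g := forall x, exists2 U, is_cball U /\ U x & ~ bad g U.

(** By restriction, no bad ball lies inside a ball that is not bad. *)
Lemma finite_bad g : tame g -> finite_set (bad g).
Proof.
move=> tg; apply: (finite_cballs um Xc) => [B []//|x].
have [U [Ub Ux] Ugood] := tg x; exists U; split => // B [Bb Bbad] [BU _].
have [V Vb gUV] := not_bad Ub Ugood.
by apply: Bbad; exact: (sim_on_restr um fss Ub Vb).
Qed.

(** Among the balls around [x] that are not bad, one of least depth is maximal
for inclusion; it exists by induction on depth. *)
Lemma max_good g x : tame g ->
  exists2 B, [/\ is_cball B, B x & ~ bad g B] & superballs B `<=` bad g.
Proof.
move=> /(_ x)[U [Ub Ux] Ug]; move: {-1}(depth U) (leqnn (depth U)) => n.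
elim: n U Ub Ux Ug => [|n IHn] U Ub Ux Ug dU;
  have [sU|] := pselect (superballs U `<=` bad g); try by exists U.
all: move=> /existsNP[V /not_implyP[[Vb UV] Vg]].
all: have dVU := depth_lt um Xc Ub Vb UV.
  by move: dVU; rewrite ltnNge (leq_trans dU).
apply: (IHn V) => //; first by case: UV => /(_ _ Ux).
by rewrite -ltnS (leq_trans dVU).
Qed.

Lemma depth_max_good g n B : is_cball B -> superballs B `<=` bad g ->
  (bad g #<= `I_n)%card -> (depth B <= n)%N.
Proof.
move=> Bb sB badn; apply: geq_card_fset_set.
exact: card_le_trans (subset_card_le sB) badn.
Qed.

(** If [g^-1] were in [Sim] on a ball [D] strictly larger than [C], then [g]
would be in [Sim] on [g^-1 D], which is strictly larger than [B]. *)
Lemma max_good_image g B C : is_cball B -> is_cball C -> sim_on Sim g B C ->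
  superballs B `<=` bad g -> superballs C `<=` bad (g^-1)%g.
Proof.
move=> Bb Cb gBC sB D [Db [CD nDC]]; split => // -[D' D'b gDD'].
have [gK fK] := LS_invP g.
have gD'D : sim_on Sim g D' D by apply/sim_on_LSinv.
have gB := sim_on_image fss Bb Cb gBC.
have gD' := sim_on_image fss D'b Db gD'D.
have [_] : bad g D'; last by apply; exists D.
apply: sB; split => //; split=> [x Bx|D'B].
  have : C (g x) by rewrite -gB; exists x.
  by move=> /CD; rewrite -{1}gD' => -[y D'y] /(can_inj gK) <-.
by apply: nDC; rewrite -gD' -gB; exact: image_subset.
Qed.

(** The graph of such a [g] is a union of graphs over maximal balls that are
not bad; these balls and their images have depth at most [n], so the pieces
come from a finite family. *)
Lemma finite_tame n : finite_set [set g | [/\ tame g, (bad g #<= `I_n)%card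
  & (bad (g^-1)%g #<= `I_n)%card]].
Proof.
set G := [set g | _].
pose F := [set B : set X | is_cball B /\ (depth B <= n)%N].
pose pieces := \bigcup_(p in F `*` F)
  [set graph g p.1 | g in [set g | sim_on Sim g p.1 p.2]].
have Ffin : finite_set F by exact: finite_shallow.
have piecesfin : finite_set pieces.
  apply: bigcup_finite; first exact: finite_setX.
  by move=> [A B] [[/= Ab _] [Bb _]]; exact: finite_graphs.
pose gr (g : LS X) := graph g setT.
have gr_inj : injective gr.
  move=> g h gh; apply: LS_ext => x.
  have : gr g (x, g x) by exists x.
  by rewrite gh => -[_ _ [-> ->]].
apply: (@sub_finite_set _ _ (gr @^-1` (gr @` G))); first by move=> g Gg; exists g.
apply: finite_preimage; first by move=> g h _ _; exact: gr_inj.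
apply: (finite_unions piecesfin) => _ [g [tg gn ign] <-] _ [x _ <-].
have [B [Bb Bx Bg] sB] := max_good x tg.
have [C Cb gBC] := not_bad Bb Bg.
have sC := max_good_image Bb Cb gBC sB.
exists (graph g B); last by split; [exists x|move=> _ [y _ <-]; exists y].
exists (B, C); last by exists g.
by split; split => //=; [exact: depth_max_good gn|exact: depth_max_good ign].
Qed.

End Bad.

(** * The zipper action *)

Section Zipper.
Context {R : realType} {X : metricType R}.
Variable Sim : forall A B : set X, set (A -> B).
Hypothesis fss : finite_similarity_structure Sim.
Implicit Types (A B C : set X) (g : LS X).

(** The class of the inclusion of [B], where (f, A) and (f', A') are equivalent
when some [h] in [Sim A A'] satisfies f' h = f on A. *)
Definition zclass B : set (LS X * set X) :=
  [set p : LS X * set X | is_cball p.2 /\ sim_on Sim p.1 p.2 B].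

Definition translate g (E : set (LS X * set X)) : set (LS X * set X) :=
  [set p | E ((g^-1 * p.1)%g, p.2)].

Definition zipper : set (set (LS X * set X)) := zclass @` @is_cball R X.

Lemma translate1 E : translate 1%g E = E.
Proof.
by apply/seteqP; split => -[f B]; rewrite /translate /= invg1 mul1g.
Qed.

Lemma translateM g h E : translate (g * h)%g E = translate g (translate h E).
Proof.
by apply/seteqP; split => -[f B]; rewrite /translate /= invgM mulgA.
Qed.

Lemma translate_inj g : injective (translate g).
Proof.
move=> E F EF; rewrite -(translate1 E) -(translate1 F) -(mulVg g).
by rewrite !translateM EF.
Qed.

(** The pair [(g, B)] lies in the translate of [zclass B]; it lies in
[zclass C] exactly when [g] is in [Sim] from [B] to [C]. *)
Lemma translate_zclass g B C : is_cball B -> is_cball C ->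
  translate g (zclass B) = zclass C <-> sim_on Sim g B C.
Proof.
move=> Bb Cb; split=> [gBC|gBC].
  have : translate g (zclass B) (g, B).
    (* Unfolds the membership without reducing the group product. *)
    change (zclass B ((g^-1 * g)%g, B)); rewrite mulVg.
    by split => //; exact: sim_on_id.
  by rewrite gBC => -[].
have gCB : sim_on Sim (g^-1)%g C B by exact: (sim_on_LSinv fss g Bb Cb).1 gBC.
apply/seteqP; split => -[f A].
  move=> [Ab fA]; split => //.
  rewrite -[(f, A).1](mulVKg g f).
  exact: (sim_on_comp fss Ab Bb Cb fA gBC).
move=> [Ab fA]; split => //.
exact: (sim_on_comp fss Ab Cb Bb fA gCB).
Qed.

Lemma zclass_inj B C : is_cball B -> is_cball C -> zclass B = zclass C -> B = C.
Proof.
move=> Bb Cb; rewrite -{1}(translate1 (zclass B)).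
move=> /(translate_zclass _ Bb Cb)/(sim_on_image fss Bb Cb).
by rewrite image_id.
Qed.

Lemma zipper_moved g :
  (translate g @` zipper) `\` zipper = (translate g \o zclass) @` bad Sim g.
Proof.
apply/seteqP; split => [_ [[_ [B Bb <-] <-] nZ]|_ [B [Bb Bbad] <-]].
  exists B => //; split => // -[C Cb gBC]; apply: nZ; exists C => //.
  by apply/esym/translate_zclass.
split; first by exists (zclass B) => //; exists B.
case=> C Cb CE; apply: Bbad; exists C => //.
by apply/translate_zclass => //; rewrite CE.
Qed.

(** By [translate_zclass], [zclass C] is the translate of [zclass B] exactly
when [g^-1] is in [Sim] from [C] to [B]. *)
Lemma zipper_missed g :
  zipper `\` (translate g @` zipper) = zclass @` bad Sim (g^-1)%g.
Proof.
apply/seteqP; split => [_ [[C Cb <-] nZ]|_ [C [Cb Cbad] <-]].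
  exists C => //; split => // -[B Bb /(sim_on_LSinv fss _ Cb Bb)].
  rewrite invgK => gBC; apply: nZ; exists (zclass B); first by exists B.
  exact/translate_zclass.
split; first by exists C.
case=> _ [B Bb <-] /(translate_zclass _ Bb Cb) gBC; apply: Cbad; exists B => //.
exact: (sim_on_LSinv fss g Bb Cb).1 gBC.
Qed.

Lemma bad_card_le g :
  (bad Sim g #<= (translate g @` zipper) `+` zipper)%card.
Proof.
have eq_bad : ((translate g \o zclass) @` bad Sim g #= bad Sim g)%card.
  apply: inj_card_eq => B C /set_mem[Bb _] /set_mem[Cb _] /translate_inj.
  exact: zclass_inj.
rewrite -(card_le_eql eq_bad); apply: subset_card_le.
by rewrite -zipper_moved; left.
Qed.

Lemma bad_inv_card_le g :
  (bad Sim (g^-1)%g #<= (translate g @` zipper) `+` zipper)%card.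
Proof.
have eq_bad : (zclass @` bad Sim (g^-1)%g #= bad Sim (g^-1)%g)%card.
  by apply: inj_card_eq => B C /set_mem[Bb _] /set_mem[Cb _]; exact: zclass_inj.
rewrite -(card_le_eql eq_bad); apply: subset_card_le.
by rewrite -zipper_missed; right.
Qed.

End Zipper.

Theorem theorem6p1 (R : realType) (X : metricType R)
    (S : {pred LS X}) (Gamma : subGroupType S) :
  ultrametric X ->
  compact [set: X] ->
  locally_finitely_determined [set g : LS X | g \in S] ->
  has_zipper_action R Gamma.
Proof.
move=> um Xc [Sim [fss ld]].
have tG (g : Gamma) : tame Sim (val g).
  move=> x; have [r [l [r0 l0 [h [hg _ _ Sh]]]]] := ld _ (valP g) x.
  exists (cball x r).
    by split; [exact: is_cball_cball|exact: cball_center].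
  case=> _; apply; exists (cball (val g x) (l * r)); last by exists h.
  by apply: is_cball_cball; rewrite mulr_gt0.
exists (set (LS X * set X)), (fun g : Gamma => translate (val g)), (zipper Sim).
split.
- split=> [E|g h E]; first by rewrite val1 translate1.
  by rewrite valM translateM.
- move=> g; rewrite /setY (zipper_moved fss) (zipper_missed fss) finite_setU.
  split; apply: finite_image; apply: finite_bad => //.
  by rewrite -gmulfV; exact: tG.
- (* Symmetric differences of size at most r leave at most n bad balls. *)
  move=> r r0; pose n := Num.bound r.
  apply: (@sub_finite_set _ _ ((val : Gamma -> LS X) @^-1`
    [set g | [/\ tame Sim g, (bad Sim g #<= `I_n)%card
      & (bad Sim (g^-1)%g #<= `I_n)%card]])); last first.
    apply: finite_preimage; first by move=> g h _ _; exact: val_inj.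
    exact: finite_tame.
  move=> g [m card_m mr].
  have mn : (`I_m #<= `I_n)%card.
    rewrite card_le_II -(ler_nat R) (le_trans mr)// ltW//.
    exact/archi_boundP/ltW.
  split => //.
    apply: card_le_trans (bad_card_le fss _) _.
    by rewrite (card_le_eql card_m).
  apply: card_le_trans (bad_inv_card_le fss _) _.
  by rewrite (card_le_eql card_m).
Qed.
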